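(* Let $J\subset(0,4)$ be a compact interval. For every $\beta\in J$, the linearized interface system $$\xi''=(\Gamma_\beta^2+\beta(3\Phi_\beta^2-1))\xi+2\Gamma_\beta\Phi_\beta\psi,\qquad \psi''=4\Gamma_\beta\Phi_\beta\xi+2\Phi_\beta^2\psi$$ has no nonzero solution on $\mathbb R$ which satisfies $\psi(-\infty)=\psi'(-\infty)=0$, is scalar-recessive at $-\infty$, and decays at $+\infty$. There is $K_0=K_0(J)$ such that, for every fixed $K\ge K_0$, the linear matching map $\mathcal M_{\beta,K}:\mathbb R^3\to\mathbb R^4$, $$\mathcal M_{\beta,K}(a,b_1,b_2)=T_\beta(K,-K)\,a\,\ell_\beta^-(-K)-b_1Z_{H,\beta}(K)-b_2Z_{G,\beta}(K),$$ has rank three for every $\beta\in J$. Moreover, there is $c_{J,K}>0$ such that $$|\mathcal M_{\beta,K}z|\ge c_{J,K}|z|,\qquad \beta\in J,\ z\in\mathbb R^3 .$$ The same rank condition then holds at every other matching point: for every $y_*\in\mathbb R$ the map $(a,b_1,b_2)\mapsto T_\beta(y_*,-K)a\ell_\beta^-(-K)-b_1Z_{H,\beta}(y_* )-b_2Z_{G,\beta}(y_* )$ has rank three.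
   Context: For $0<\beta<4$ let $(\Phi_\beta,\Gamma_\beta)$ be the unique solution on $\mathbb R$ of $\Phi''=\Gamma^2\Phi+\beta\Phi(\Phi^2-1)$, $\Gamma''=2\Gamma\Phi^2$ with $\Phi(y)\to0$, $\Gamma(y)+\sqrt\beta\,y\to0$ as $y\to-\infty$ and $\Phi(y)\to1$, $\Gamma(y)\to0$ as $y\to+\infty$ (Chapman–Howison–McLeod–Ockendon interface). It satisfies $0<\Phi_\beta<1$, $\Phi_\beta'>0$, $\Gamma_\beta>0$, $-\sqrt\beta<\Gamma_\beta'<0$, $\Gamma_\beta''>0$. Solutions of the linearized system are identified with their Cauchy vectors $Z=(\xi,\psi,\xi',\psi')^t\in\mathbb R^4$. $T_\beta(y_1,y_0)$ is the transfer matrix of the linearized system, mapping the Cauchy vector at $y_0$ to that at $y_1$. A solution is scalar-recessive at $-\infty$ if $\lim_{y\to-\infty}\xi(y)\big/\big(|y|^{(\sqrt\beta-1)/2}e^{-\sqrt\beta y^2/2}\big)$ exists and is finite. For $\beta\in J$ and $Y$ sufficiently large (depending on $J$), the Cauchy data at $y=-Y$ of solutions which are scalar-recessive at $-\infty$ and satisfy $\psi(-\infty)=\psi'(-\infty)=0$ form a one-dimensional space $E_\beta^-(-Y)\subset\mathbb R^4$, depending continuously on $\beta$; $\ell_\beta^-(-Y)$ is its spanning vector with first coordinate equal to one. The solutions of the linearized system which decay as $y\to+\infty$ form a two-dimensional space. $Z_{H,\beta},Z_{G,\beta}$ is a basis of it, chosen continuously in $\beta\in J$, such that for some $c>0$ and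 all sufficiently large $y$, uniformly in $\beta\in J$, $$Z_{H,\beta}(y)=e^{-\sqrt{2\beta}y}\big((1,0,-\sqrt{2\beta},0)^t+O(e^{-cy})\big),\qquad Z_{G,\beta}(y)=e^{-\sqrt2y}\big((0,1,0,-\sqrt2)^t+O(e^{-cy})\big);$$ these solutions are extended to all of $\mathbb R$ by the exact flow. *)

(* Defs.v *)
From HB Require Import structures.
From mathcomp Require Import all_boot all_order all_algebra.
From mathcomp Require Import all_classical all_reals all_analysis.

Set Implicit Arguments.
Unset Strict Implicit.
Unset Printing Implicit Defensive.

Import Order.TTheory GRing.Theory Num.Theory.
Import numFieldNormedType.Exports.

Local Open Scope ring_scope.
Local Open Scope classical_set_scope.

Definition twice_derivable (R : realType) (f : R -> R) : Prop :=
  (forall y, derivable f y 1) /\ (forall y, derivable f^`() y 1).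

Definition interface (R : realType) (beta : R) (Phi Gamma : R -> R) : Prop :=
  [/\ twice_derivable Phi /\ twice_derivable Gamma,
      forall y, Phi^`(2) y =
        Gamma y ^+ 2 * Phi y + beta * Phi y * (Phi y ^+ 2 - 1),
      forall y, Gamma^`(2) y = 2 * Gamma y * Phi y ^+ 2,
      Phi y @[y --> -oo] --> (0 : R) /\
        Gamma y + Num.sqrt beta * y @[y --> -oo] --> (0 : R) &
      Phi y @[y --> +oo] --> (1 : R) /\ Gamma y @[y --> +oo] --> (0 : R)].

Definition unique_interface (R : realType) (beta : R) (Phi Gamma : R -> R) :
  Prop :=
  interface beta Phi Gamma /\
  (forall Phi1 Gamma1 : R -> R, interface beta Phi1 Gamma1 ->
     forall y, Phi1 y = Phi y /\ Gamma1 y = Gamma y).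

Definition interface_shape (R : realType) (beta : R) (Phi Gamma : R -> R) :
  Prop :=
  forall y, [/\ 0 < Phi y < 1, 0 < Phi^`() y, 0 < Gamma y,
                - Num.sqrt beta < Gamma^`() y < 0 & 0 < Gamma^`(2) y].

Definition col4 (R : realType) (a b c d : R) : 'cV[R]_4 :=
  \col_(i < 4) [:: a; b; c; d]`_i.

Definition xi_of (R : realType) (Z : R -> 'cV[R]_4) : R -> R :=
  fun y => Z y 0 0.

Definition psi_of (R : realType) (Z : R -> 'cV[R]_4) : R -> R :=
  fun y => Z y 1 0.

(* A solution is carried by its Cauchy vector Z = (xi, psi, xi', psi')^t. *)
Definition lin_solution (R : realType) (beta : R) (Phi Gamma : R -> R)
    (Z : R -> 'cV[R]_4) : Prop :=
  let xi := xi_of Z in let psi := psi_of Z in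
  [/\ twice_derivable xi /\ twice_derivable psi,
      forall y, Z y = col4 (xi y) (psi y) (derive1 xi y) (derive1 psi y),
      forall y, xi^`(2) y =
        (Gamma y ^+ 2 + beta * (3 * Phi y ^+ 2 - 1)) * xi y
        + 2 * Gamma y * Phi y * psi y &
      forall y, psi^`(2) y =
        4 * Gamma y * Phi y * xi y + 2 * Phi y ^+ 2 * psi y].

Definition is_transfer (R : realType) (beta : R) (Phi Gamma : R -> R)
    (T : R -> R -> 'M[R]_4) : Prop :=
  forall Z, lin_solution beta Phi Gamma Z ->
    forall y1 y0, Z y1 = T y1 y0 *m Z y0.

Definition scalar_recessive (R : realType) (beta : R) (Z : R -> 'cV[R]_4) :
  Prop :=
  exists l : R,
    xi_of Z y / (`|y| `^ ((Num.sqrt beta - 1) / 2)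
                 * expR (- (Num.sqrt beta * y ^+ 2 / 2))) @[y --> -oo] --> l.

Definition psi_vanishes (R : realType) (Z : R -> 'cV[R]_4) : Prop :=
  psi_of Z y @[y --> -oo] --> (0 : R) /\
  (psi_of Z)^`() y @[y --> -oo] --> (0 : R).

Definition decays (R : realType) (Z : R -> 'cV[R]_4) : Prop :=
  xi_of Z y @[y --> +oo] --> (0 : R) /\ psi_of Z y @[y --> +oo] --> (0 : R).

Definition Eminus (R : realType) (beta : R) (Phi Gamma : R -> R) (y0 : R) :
  set 'cV[R]_4 :=
  [set v | exists Z, [/\ lin_solution beta Phi Gamma Z,
     scalar_recessive beta Z, psi_vanishes Z & Z y0 = v]].

(* ell beta y is only constrained for y = - Y with Y large. *)
Definition Eminus_spanned (R : realType) (J : set R) (Phi Gamma : R -> R -> R)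
    (ell : R -> R -> 'cV[R]_4) : Prop :=
  exists Y0 : R, forall Y, Y0 <= Y ->
    {within J, continuous (fun beta => ell beta (- Y))} /\
    (forall beta, J beta ->
       ell beta (- Y) 0 0 = 1 /\
       Eminus beta (Phi beta) (Gamma beta) (- Y) =
         [set a *: ell beta (- Y) | a in [set: R]]).

Definition enorm (R : realType) (n : nat) (v : 'cV[R]_n) : R :=
  Num.sqrt (\sum_(i < n) v i 0 ^+ 2).

Definition basis_of_decaying (R : realType) (beta : R) (Phi Gamma : R -> R)
    (Z1 Z2 : R -> 'cV[R]_4) : Prop :=
  [/\ lin_solution beta Phi Gamma Z1 /\ decays Z1,
      lin_solution beta Phi Gamma Z2 /\ decays Z2,
      forall b1 b2 : R, (forall y, b1 *: Z1 y + b2 *: Z2 y = 0) ->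
        b1 = 0 /\ b2 = 0 &
      forall Z, lin_solution beta Phi Gamma Z -> decays Z ->
        exists b1 b2 : R, forall y, Z y = b1 *: Z1 y + b2 *: Z2 y].

Definition asymptotic_basis (R : realType) (J : set R)
    (Phi Gamma : R -> R -> R) (ZH ZG : R -> R -> 'cV[R]_4) : Prop :=
  [/\ forall beta, J beta ->
        basis_of_decaying beta (Phi beta) (Gamma beta) (ZH beta) (ZG beta),
      forall y, {within J, continuous (fun beta => ZH beta y)} /\
                {within J, continuous (fun beta => ZG beta y)} &
      exists c C Y1 : R, 0 < c /\
        forall beta y, J beta -> Y1 <= y ->
          enorm (expR (Num.sqrt (2 * beta) * y) *: ZH beta y
                 - col4 1 0 (- Num.sqrt (2 * beta)) 0) <= C * expR (- c * y) /\
          enorm (expR (Num.sqrt 2 * y) *: ZG beta y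
                 - col4 0 1 0 (- Num.sqrt 2)) <= C * expR (- c * y)].

Definition matching (R : realType) (T : 'M[R]_4) (l H G : 'cV[R]_4)
    (z : 'cV[R]_3) : 'cV[R]_4 :=
  T *m (z 0 0 *: l) - z 1 0 *: H - z 2 0 *: G.

Fact matching_is_linear (R : realType) (T : 'M[R]_4) (l H G : 'cV[R]_4) :
  linear (matching T l H G).
Proof.
move=> a u v; rewrite /matching !mxE !scalerBr !scalerDl -!scalerA.
rewrite mulmxDr -!scalemxAr !opprD.
by rewrite [RHS]addrACA [X in _ = X + _]addrACA.
Qed.

HB.instance Definition _ (R : realType) (T : 'M[R]_4) (l H G : 'cV[R]_4) :=
  GRing.isLinear.Build R 'cV[R]_3 'cV[R]_4 _ (matching T l H G)
    (matching_is_linear T l H G).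

Definition lin_rank (R : realType) (m n : nat)
    (f : {linear 'cV[R]_m -> 'cV[R]_n}) : nat :=
  \dim (limg (linfun f)).

(* Main.v *)
Require Import Defs.
From mathcomp Require Import all_boot all_order all_algebra.
From mathcomp Require Import all_classical all_reals all_analysis.
From mathcomp Require Import ring lra.
Import Order.TTheory GRing.Theory Num.Theory.
Import numFieldNormedType.Exports.
Local Open Scope ring_scope.
Local Open Scope classical_set_scope.

(** The translation mode (Phi', Gamma') solves the linearized system, and
    Phi' > 0 > Gamma' while the coupling 2 Gamma Phi is positive.  So the
    system for (xi, - psi) is cooperative and (Phi', - Gamma') is a positive
    ground state of it.  Substituting xi = Phi' u and psi = Gamma' v, Jacobi's
    identity reads

      (Phi'^2 u u' + Gamma'^2 v v' / 2)'
        = Phi'^2 u'^2 + Gamma'^2 v'^2 / 2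
          + 2 Gamma Phi Phi' |Gamma'| (u - v)^2,

    with a right-hand side that is never negative ([is_derive_flux],
    [dissipation_ge0]).  The flux on the left is therefore nondecreasing.  If
    it were eventually bounded away from zero with the wrong sign at an end of
    the line, then xi^2 / 2 + psi^2 / 4 (or xi^2 / 2) would grow at least
    linearly there, which decay forbids ([flux_le0] at +oo, [flux_ge0] at -oo).
    So the flux vanishes, u = v is a constant c, and psi = c Gamma'.  Since
    Gamma' stays away from 0 at -oo while psi tends to 0, c = 0
    ([recessive_decaying_eq0]): the translation mode is excluded by the
    condition on psi alone.

    A kernel vector of a matching map gives a solution that vanishes at one
    point, hence everywhere, and so a recessive solution that equals a decaying
    one.  It is zero, and all the matching maps are injective
    ([matching_injective]).

    The uniform lower bound is obtained at - K and transported to K: a matching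
    vector at K is the value at K of a solution D whose value at - K is the
    matching vector there, with identity transfer.  The latter depends
    continuously on beta and injectively on z, so compactness bounds it below
    ([uniformly_injective]).  Gronwall's inequality read backwards bounds
    |D (- K)| by a multiple of |D K| ([energy_backward]), with a constant that
    involves only bounds of Phi and Gamma on [- K, K].  Those are uniform in beta because the normalization
    Gamma + sqrt beta y -> 0 at -oo fixes the position of the interface and
    forces Gamma 0 <= 3 ([Gamma0_le]). *)

(** * Differential inequalities *)

Section Calculus.
Set Implicit Arguments.
Unset Strict Implicit.
Variable R : realType.
Implicit Types (f p dp ddp : R -> R) (a b c d x y M : R).

Lemma derive_ge_slope f (df : R -> R) a b d : a <= b ->
  (forall y, is_derive y 1 f (df y)) ->
  (forall y, a <= y <= b -> d <= df y) -> f a + d * (b - a) <= f b.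
Proof.
move=> ab Df dle.
have cf : {within `[a, b], continuous f}.
  by apply: derivable_within_continuous => y _; case: (Df y).
have [y yab e] := MVT_segment ab (fun y _ => Df y) cf.
rewrite -lerBrDl e ler_wpM2r ?subr_ge0// dle//.
Qed.

Lemma derive_ge0_le f (df : R -> R) a b : a <= b ->
  (forall y, is_derive y 1 f (df y)) ->
  (forall y, a <= y <= b -> 0 <= df y) -> f a <= f b.
Proof.
by move=> ab Df /(derive_ge_slope ab Df); rewrite mul0r addr0.
Qed.

Lemma cvg0_pinfty f e : 0 < e -> f y @[y --> +oo] --> (0 : R) ->
  exists a, forall y, a <= y -> `|f y| <= e.
Proof.
move=> e0 /cvgr0Pnorm_le /(_ e e0) [a [_ ha]].
by exists (a + 1) => y ay; apply: ha; rewrite /=; lra.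
Qed.

Lemma cvg0_ninfty f e : 0 < e -> f y @[y --> -oo] --> (0 : R) ->
  exists a, forall y, y <= a -> `|f y| <= e.
Proof.
move=> e0 /cvgr0Pnorm_le /(_ e e0) [a [_ ha]].
by exists (a - 1) => y ay; apply: ha; rewrite /=; lra.
Qed.

Lemma is_deriveV f (df : R) y : f y != 0 -> is_derive y 1 f df ->
  is_derive y 1 (fun x => (f x)^-1) (- df / f y ^+ 2).
Proof.
move=> fy0 Df; have [Df1 Df2] := Df.
apply: DeriveDef; first exact: derivableV.
by rewrite deriveV// Df2 /GRing.scale/= !mulNr mulrC.
Qed.

Lemma is_derive_expR_scale c y :
  is_derive y 1 (fun x => expR (c * x)) (c * expR (c * y)).
Proof.
have : is_derive y 1 (expR \o (c \*: @id R)) (expR (c * y) * (c *: 1)).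
  by apply: is_derive1_comp.
by rewrite /GRing.scale/= mulr1 mulrC.
Qed.

Lemma slope_unbounded_pinfty f (df : R -> R) a d B : 0 < d ->
  (forall y, is_derive y 1 f (df y)) ->
  (forall y, a <= y -> d <= df y) -> (forall y, a <= y -> f y <= B) -> False.
Proof.
move=> d0 Df dle fB.
pose b := a + (`|B - f a| + 1) / d.
have ab : a <= b by rewrite lerDl divr_ge0// ?addr_ge0// ltW.
have := derive_ge_slope ab Df (fun y h => dle y (proj1 (andP h))).
have -> : d * (b - a) = `|B - f a| + 1 by rewrite /b; field; rewrite gt_eqF.
have := fB b ab; have := ler_norm (B - f a); lra.
Qed.

Lemma slope_unbounded_ninfty f (df : R -> R) a d B : 0 < d ->
  (forall y, is_derive y 1 f (df y)) ->
  (forall y, y <= a -> df y <= - d) -> (forall y, y <= a -> f y <= B) -> False.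
Proof.
move=> d0 Df dle fB.
have Dg y : is_derive y 1 (f \o -%R) (- df (- y)).
  have := is_derive1_comp (Df (- y)) (is_deriveNid y 1).
  by rewrite mulrN1.
apply: (@slope_unbounded_pinfty _ _ (- a) d B d0 Dg) => y ay; last first.
  by rewrite /= fB// lerNl.
by rewrite lerNr dle// lerNl.
Qed.

(** Here dp + M p solves a first-order inequality: once negative, it stays
    below - e * expR (M y), and p * expR (M y) then decreases linearly until p
    is negative.  This bounds the logarithmic derivative of a positive
    subsolution from below without knowing its asymptotics. *)
Lemma log_derivative_ge p dp ddp M a : 0 < M ->
  (forall y, is_derive y 1 p (dp y)) -> (forall y, is_derive y 1 dp (ddp y)) ->
  (forall y, a <= y -> 0 < p y) ->
  (forall y, a <= y -> ddp y <= M ^+ 2 * p y) ->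
  forall y, a <= y -> - M * p y <= dp y.
Proof.
move=> M0 Dp Ddp p0 hp y0 ay0; rewrite leNgt; apply/negP => lt0.
pose w y := (dp y + M * p y) * expR (- M * y).
pose dw y := (ddp y - M ^+ 2 * p y) * expR (- M * y).
have Dw y : is_derive y 1 w (dw y).
  have -> : w = (dp + cst M * p) * (fun x => expR (- M * x)) by [].
  have De := is_derive_expR_scale (- M) y.
  apply: is_derive_eq.
  rewrite /GRing.scale/= ?fctE /dw /=; ring.
have Dwn y : is_derive y 1 (- w) (- dw y) by apply: is_deriveN.
have wle y : y0 <= y -> w y <= w y0.
  move=> yy0; rewrite -lerN2.
  apply: (derive_ge0_le yy0 Dwn) => x /andP[xy _].
  rewrite oppr_ge0 /dw pmulr_lle0 ?expR_gt0// subr_le0 hp//; lra.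
pose e := - w y0.
have e0 : 0 < e by rewrite oppr_gt0 /w pmulr_llt0 ?expR_gt0//; lra.
pose v y := p y * expR (M * y).
have Dv y : is_derive y 1 (- v) (- (w y * expR (M * y) ^+ 2)).
  apply: is_deriveN.
  have -> : v = p * (fun x => expR (M * x)) by [].
  have De := is_derive_expR_scale M y.
  apply: is_derive_eq.
  rewrite /GRing.scale/= /w mulNr expRN; field.
  by rewrite gt_eqF ?expR_gt0.
apply: (@slope_unbounded_pinfty _ _ y0 (e * expR (M * y0) ^+ 2) 0 _ Dv).
- by rewrite mulr_gt0 ?exprn_gt0 ?expR_gt0.
- move=> y yy0; rewrite -mulNr ler_pM ?sqr_ge0 ?(ltW e0)//.
    by rewrite lerN2 wle.
  by rewrite lerXn2r ?nnegrE ?expR_ge0// ler_expR ler_wpM2l// ltW.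
- move=> y yy0; rewrite /v fctE oppr_le0 mulr_ge0 ?expR_ge0// ltW// p0//; lra.
Qed.

End Calculus.

(** * The interface and the flux identity *)

Section Profile.
Set Implicit Arguments.
Unset Strict Implicit.

(** Differentiating [Phi_rhs] and [Gamma_rhs] along the interface gives
    [xi_rhs] and [psi_rhs] at (Phi', Gamma'): the translation mode. *)
Definition Phi_rhs (R : realType) (beta : R) (P G : R -> R) (y : R) : R :=
  G y ^+ 2 * P y + beta * P y * (P y ^+ 2 - 1).

Definition Gamma_rhs (R : realType) (P G : R -> R) (y : R) : R :=
  2 * G y * P y ^+ 2.

Definition xi_rhs (R : realType) (beta : R) (P G xi psi : R -> R) (y : R) : R :=
  (G y ^+ 2 + beta * (3 * P y ^+ 2 - 1)) * xi y + 2 * G y * P y * psi y.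

Definition psi_rhs (R : realType) (P G xi psi : R -> R) (y : R) : R :=
  4 * G y * P y * xi y + 2 * P y ^+ 2 * psi y.

(** The facts about the interface that the proofs use, with the derivatives
    carried as functions [P1] and [G1] so that every differentiation is an
    [is_derive] statement. *)
Record profile (R : realType) (beta : R) (P P1 G G1 : R -> R) : Prop :=
  Profile {
  beta_gt0 : 0 < beta;
  is_derive_Phi : forall y : R, is_derive y 1 P (P1 y);
  is_derive_dPhi : forall y : R, is_derive y 1 P1 (Phi_rhs beta P G y);
  is_derive_Gamma : forall y : R, is_derive y 1 G (G1 y);
  is_derive_dGamma : forall y : R, is_derive y 1 G1 (Gamma_rhs P G y);
  Phi_gt0 : forall y, 0 < P y;
  Phi_lt1 : forall y, P y < 1;
  dPhi_gt0 : forall y, 0 < P1 y;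
  Gamma_gt0 : forall y, 0 < G y;
  dGamma_lt0 : forall y, G1 y < 0;
  dGamma_gt : forall y, - Num.sqrt beta < G1 y;
  Phi_cvg0 : P y @[y --> -oo] --> (0 : R);
  Gamma_asymp : G y + Num.sqrt beta * y @[y --> -oo] --> (0 : R) }.

End Profile.

Section Interface.
Set Implicit Arguments.
Unset Strict Implicit.
Variables (R : realType) (beta : R) (P P1 G G1 : R -> R).
Hypothesis prof : profile beta P P1 G G1.
Implicit Types (a b x y z : R).
Local Notation P2 := (Phi_rhs beta P G).
Local Notation G2 := (Gamma_rhs P G).
Local Notation P3 := (xi_rhs beta P G P1 G1).
Local Notation G3 := (psi_rhs P G P1 G1).
Let beta_gt0 := prof.(beta_gt0).
Let DP := prof.(is_derive_Phi).
Let DP1 := prof.(is_derive_dPhi).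
Let DG := prof.(is_derive_Gamma).
Let DG1 := prof.(is_derive_dGamma).
Let Phi_gt0 := prof.(Phi_gt0).
Let Phi_lt1 := prof.(Phi_lt1).
Let dPhi_gt0 := prof.(dPhi_gt0).
Let Gamma_gt0 := prof.(Gamma_gt0).
Let dGamma_lt0 := prof.(dGamma_lt0).
Let dGamma_gt := prof.(dGamma_gt).

Lemma is_derive_Phi_rhs y : is_derive y 1 P2 (P3 y : R).
Proof.
have -> : P2 = G ^+ 2 * P + cst beta * P * (P ^+ 2 - cst 1) by [].
have := (DP y, DG y, DP1 y, DG1 y) => -[[[? ?] ?] ?].
apply: is_derive_eq.
rewrite /GRing.scale/= ?fctE /xi_rhs /=; ring.
Qed.

Lemma is_derive_Gamma_rhs y : is_derive y 1 G2 (G3 y).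
Proof.
have -> : G2 = cst 2 * G * P ^+ 2 by [].
have := (DP y, DG y, DP1 y, DG1 y) => -[[[? ?] ?] ?].
apply: is_derive_eq.
rewrite /GRing.scale/= ?fctE /psi_rhs /=; ring.
Qed.

Lemma Gamma_nincr x y : x <= y -> G y <= G x.
Proof.
move=> xy; rewrite -lerN2.
apply: (derive_ge0_le xy (fun z => is_deriveN (DG z))) => z _ /=.
by rewrite oppr_ge0 ltW.
Qed.

Lemma dGamma_ndecr x y : x <= y -> G1 x <= G1 y.
Proof.
move=> xy; apply: (derive_ge0_le xy DG1) => z _.
by rewrite /Gamma_rhs mulr_ge0 ?sqr_ge0// mulr_ge0// ltW.
Qed.

(** At +oo this is the control of Phi'' / Phi' from below; it comes from
    Phi''' <= (Gamma^2 + beta (3 Phi^2 - 1)) Phi', the coupling term in Gamma'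
    being negative. *)
Lemma Phi_rhs_ge a y : a <= y -> - (G a + 2 * beta + 1) * P1 y <= P2 y.
Proof.
have := Gamma_gt0 a => Ga ay; have b0 := beta_gt0.
have M0 : 0 < G a + 2 * beta + 1 by lra.
apply: (log_derivative_ge M0 DP1 is_derive_Phi_rhs) ay => // z az.
have := Phi_gt0 z; have := Phi_lt1 z.
have := Gamma_gt0 z; have := Gamma_nincr az.
have := dPhi_gt0 z; have := dGamma_lt0 z => g1 p1 gle g0 lt1 p0.
apply: (@le_trans _ _ ((G z ^+ 2 + beta * (3 * P z ^+ 2 - 1)) * P1 z)).
  by rewrite /xi_rhs gerDl mulr_ge0_le0// ?mulr_ge0// ltW.
rewrite ler_pM2r//.
have h1 : G z ^+ 2 <= G a ^+ 2 by rewrite lerXn2r ?nnegrE// ltW.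
have h2 : P z ^+ 2 <= 1 by rewrite expr_le1 ?(ltW p0) ?(ltW lt1).
have h3 : beta * (3 * P z ^+ 2 - 1) <= 2 * beta.
  by rewrite mulrC ler_pM2r//; lra.
have h4 : 0 <= G a * beta by rewrite mulr_ge0// ltW.
nra.
Qed.

(** Same argument with p = - Gamma', for which p'' <= 2 Phi^2 p <= 4 p. *)
Lemma Gamma_rhs_le y : G2 y <= - 2 * G1 y.
Proof.
have D1 z : is_derive z 1 (- G1) (- G2 z) by apply: is_deriveN.
have D2 z : is_derive z 1 (- G2) (- G3 z).
  exact: is_deriveN (is_derive_Gamma_rhs z).
suff : - 2 * (- G1) y <= (- G2) y by rewrite !fctE; lra.
apply: (log_derivative_ge _ D1 D2 _ _ (lexx y)) => // z _;
  rewrite fctE ?oppr_gt0//.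
have := Phi_gt0 z; have := Phi_lt1 z => lt1 p0.
have h2 : P z ^+ 2 <= 1 by rewrite expr_le1 ?(ltW p0) ?(ltW lt1).
have h3 : 0 <= 4 * G z * P z * P1 z by rewrite !mulr_ge0// ltW.
have := dGamma_lt0 z; rewrite /psi_rhs; nra.
Qed.

(** Where Gamma^2 - beta >= 1, Phi'' >= Phi, so Phi'^2 - Phi^2 is
    nondecreasing; a negative value would persist down to -oo, where
    Phi tends to 0. *)
Lemma Phi_le_dPhi a :
  (forall y, y <= a -> 1 + beta <= G y ^+ 2) ->
  forall y, y <= a -> P y <= P1 y.
Proof.
move=> hG y ya.
rewrite leNgt; apply/negP => lt.
pose h := P1 ^+ 2 - P ^+ 2.
have Dh z : is_derive z 1 h (2 * P1 z * (P2 z - P z)).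
  have DPz := DP z; have DP1z := DP1 z.
  apply: is_derive_eq; rewrite /GRing.scale/= ?fctE /=; ring.
have hy : h y < 0.
  rewrite /h !fctE subr_lt0.
  by rewrite ltrXn2r ?nnegrE ?(ltW (Phi_gt0 _)) ?(ltW (dPhi_gt0 _)).
have hle z : z <= y -> h z <= h y.
  move=> zy; apply: (derive_ge0_le zy Dh) => x /andP[_ xy].
  rewrite mulr_ge0// ?mulr_ge0 ?(ltW (dPhi_gt0 _))//.
  have -> : P2 x - P x = P x * (G x ^+ 2 - (1 + beta) + beta * P x ^+ 2).
    by rewrite /Phi_rhs; ring.
  rewrite mulr_ge0 ?(ltW (Phi_gt0 _))// addr_ge0 ?subr_ge0 ?hG ?(le_trans xy)//.
  by rewrite mulr_ge0 ?sqr_ge0// ltW.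
have e0 : 0 < Num.sqrt (- h y / 2) by rewrite sqrtr_gt0; lra.
have [b hb] := cvg0_ninfty e0 prof.(Phi_cvg0).
pose z := Num.min y b.
have zy : z <= y by rewrite ge_min lexx.
have := hb z ltac:(by rewrite ge_min lexx orbT).
rewrite gtr0_norm// => /(lerXn2r 2); rewrite !nnegrE.
move=> /(_ (ltW (Phi_gt0 _)) (sqrtr_ge0 _)).
rewrite sqr_sqrtr; last lra.
have hz : h z = P1 z ^+ 2 - P z ^+ 2 by [].
have := hle z zy; have := sqr_ge0 (P1 z); lra.
Qed.

Lemma Phi_le_expR : (forall y, y <= 0 -> 1 + beta <= G y ^+ 2) ->
  forall y, y <= 0 -> P y <= expR y.
Proof.
move=> hG y y0.
pose f := P * (fun x => expR (-1 * x)).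
have Df z : is_derive z 1 f ((P1 z - P z) * expR (-1 * z)).
  have De := is_derive_expR_scale (-1) z; have := DP z => ?.
  apply: is_derive_eq; rewrite /GRing.scale/= ?fctE /=; ring.
have : f y <= f 0.
  apply: (derive_ge0_le y0 Df) => z /andP[_ z0].
  by rewrite mulr_ge0 ?expR_ge0// subr_ge0 (Phi_le_dPhi hG z0).
rewrite /f !fctE mulr0 expR0 mulr1 mulN1r expRN ler_pdivrMr ?expR_gt0//.
move=> /le_trans -> //; rewrite ler_piMl ?expR_ge0// ltW//.
Qed.

Lemma sqrt_beta_le2 : beta <= 4 -> Num.sqrt beta <= 2.
Proof.
move=> beta4; rewrite -(ler_pXn2r (n := 2)) ?nnegrE ?sqrtr_ge0//.
by rewrite sqr_sqrtr ?(ltW beta_gt0)//; lra.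
Qed.

(** A large Gamma 0 makes Phi decay like expR y on the left half-line, so
    Gamma'' = 2 Gamma Phi^2 is small there.  Integrating twice from -oo, where
    Gamma + sqrt beta y tends to 0, bounds g = Gamma 0 by g / 2 + 1.  The
    double integration is replaced by comparison with the function B below. *)
Lemma Gamma0_le : beta <= 4 -> G 0 <= 3.
Proof.
move=> beta4; rewrite leNgt; apply/negP => g3.
have b2 := sqrt_beta_le2 beta4.
set b := Num.sqrt beta in b2.
have b0 : 0 <= b by exact: sqrtr_ge0.
set g := G 0 in g3.
have Gg y : y <= 0 -> G y <= g - b * y.
  move=> y0; pose f := G + cst b * @id R.
  have Df z : is_derive z 1 f (G1 z + b).
    have := DG z => ?.
    apply: is_derive_eq; rewrite /GRing.scale/= ?fctE /=; ring.
  have : f y <= f 0.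
    apply: (derive_ge0_le y0 Df) => z _.
    by have := dGamma_gt z; rewrite -/b; lra.
  rewrite /f !fctE /= -/g; lra.
have Pe y : y <= 0 -> P y <= expR y.
  apply: Phi_le_expR => z z0; have := Gamma_nincr z0; rewrite -/g; nra.
(* B'' = 2 (g - 2 y) expR (2 y), the majorant of Gamma'', and both B and B'
   vanish at -oo. *)
pose a := (g + 2) / 2.
pose E y : R := expR (2 * y).
have DE z : is_derive z 1 E (2 * E z) by exact: is_derive_expR_scale.
have E0 z : 0 < E z by exact: expR_gt0.
pose B := (cst a - @id R) * E.
have DB z : is_derive z 1 B ((2 * a - 1 - 2 * z) * E z).
  have := DE z => ?.
  apply: is_derive_eq; rewrite /GRing.scale/= ?fctE /=; ring.
have Ba y : y <= 0 -> B y <= a.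
  move=> y0; have -> : a = B 0.
    by rewrite /B !fctE /E /= mulr0 expR0; ring.
  apply: (derive_ge0_le y0 DB) => z /andP[_ z0].
  rewrite mulr_ge0 ?(ltW (E0 z))//; rewrite /a; lra.
pose W := B - (G + cst b * @id R).
pose W1 := (cst (2 * a - 1) - cst 2 * @id R) * E - (G1 + cst b).
have DW z : is_derive z 1 W (W1 z).
  have := (DG z, DB z) => -[? ?].
  apply: is_derive_eq; rewrite /W1 /GRing.scale/= ?fctE /=; ring.
have DW1 z : is_derive z 1 W1 (2 * (g - 2 * z) * E z - Gamma_rhs P G z).
  have := (DG1 z, DE z) => -[? ?].
  apply: is_derive_eq; rewrite /GRing.scale/= ?fctE /a /=; lra.
have W1_ndecr x y : x <= y -> y <= 0 -> W1 x <= W1 y.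
  move=> xy y0; apply: (derive_ge0_le xy DW1) => z /andP[_ zy].
  have z0 : z <= 0 by exact: le_trans y0.
  have hE : P z ^+ 2 <= E z.
    rewrite /E mulr_natl mulr2n expRD -expr2.
    by rewrite lerXn2r ?nnegrE ?expR_ge0 ?(ltW (Phi_gt0 z)) ?Pe.
  have hg : G z <= g - 2 * z by have := Gg z z0; nra.
  rewrite subr_ge0 /Gamma_rhs ler_pM ?sqr_ge0//.
  - by rewrite mulr_ge0// ltW.
  - by rewrite ler_pM2l.
(* With tolerance q the comparison gives g <= 2 + 2 q; q <= 1 / 2 is enough. *)
have q0 : 0 < 4^-1 :> R by [].
have [c hc] := cvg0_ninfty q0 prof.(Gamma_asymp).
(* W is convex; a negative slope at y would make it unbounded at -oo. *)
have W1_ge0 y : y <= 0 -> 0 <= W1 y.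
  move=> y0; rewrite leNgt; apply/negP => lt0.
  apply: (@slope_unbounded_ninfty _ W _ (Num.min y c) (- W1 y) (a + 1) _ DW).
  - by rewrite oppr_gt0.
  - by move=> z; rewrite le_min => /andP[zy _]; rewrite opprK W1_ndecr.
  - move=> z; rewrite le_min => /andP[zy /hc /ler_normlP[gz _]].
    have := Ba z (le_trans zy y0); rewrite /W !fctE /=; rewrite -/b in gz; lra.
pose z := Num.min 0 c.
have z0 : z <= 0 by rewrite ge_min lexx.
have := hc z ltac:(by rewrite ge_min lexx orbT) => /ler_normlP[_ gz].
rewrite -/b in gz.
have : W z <= W 0.
  by apply: (derive_ge0_le z0 DW) => x /andP[_ x0]; exact: W1_ge0.
have Bz : 0 <= B z.
  by rewrite mulr_ge0 ?(ltW (E0 z))// !fctE subr_ge0 /a; lra.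
have B0 : B 0 = a by rewrite /B !fctE /E /= mulr0 expR0; ring.
have -> : W 0 = B 0 - (G 0 + b * 0) by [].
have -> : W z = B z - (G z + b * z) by [].
rewrite B0 mulr0 -/g /a; lra.
Qed.

Lemma Gamma_le K y : beta <= 4 -> 0 <= K -> - K <= y -> G y <= 3 + 2 * K.
Proof.
move=> beta4 K0 Ky.
have b2 := sqrt_beta_le2 beta4.
apply: le_trans (Gamma_nincr Ky) _.
have K0' : - K <= 0 by rewrite oppr_le0.
have := derive_ge_slope K0' DG (d := -2) => /(_ _)/wrap[].
  by move=> z _; have := dGamma_gt z; lra.
by have := Gamma0_le beta4; lra.
Qed.

Variables (xi xi1 psi psi1 : R -> R).
Hypothesis Dxi : forall y, is_derive y 1 xi (xi1 y).
Hypothesis Dxi1 : forall y, is_derive y 1 xi1 (xi_rhs beta P G xi psi y).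
Hypothesis Dpsi : forall y, is_derive y 1 psi (psi1 y).
Hypothesis Dpsi1 : forall y, is_derive y 1 psi1 (psi_rhs P G xi psi y).

(** In terms of u = xi / Phi' and v = psi / Gamma', this is
    Phi'^2 u u' + Gamma'^2 v v' / 2. *)
Definition flux y : R := xi y * xi1 y - xi y ^+ 2 * (P2 y / P1 y)
  + 2^-1 * (psi y * psi1 y - psi y ^+ 2 * (G2 y / G1 y)).

(** In terms of u and v, this is Phi'^2 u'^2 + Gamma'^2 v'^2 / 2
    - 2 Gamma Phi Phi' Gamma' (u - v)^2. *)
Definition dissipation y : R := (xi1 y - xi y * (P2 y / P1 y)) ^+ 2
  + 2^-1 * (psi1 y - psi y * (G2 y / G1 y)) ^+ 2
  - 2 * G y * P y * P1 y * G1 y * (xi y / P1 y - psi y / G1 y) ^+ 2.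

(** Jacobi's identity: it holds because (Phi', Gamma') and (xi, psi) solve the
    same system, which is symmetric once the second equation is halved. *)
Lemma is_derive_flux y : is_derive y 1 flux (dissipation y).
Proof.
have P1n0 : P1 y != 0 by rewrite gt_eqF.
have G1n0 : G1 y != 0 by rewrite lt_eqF.
have iP := is_deriveV P1n0 (DP1 y).
have iG := is_deriveV G1n0 (DG1 y).
pose iP1 (x : R) : R := (P1 x)^-1.
pose iG1 (x : R) : R := (G1 x)^-1.
have -> : flux = xi * xi1 - xi ^+ 2 * (P2 * iP1)
  + cst 2^-1 * (psi * psi1 - psi ^+ 2 * (G2 * iG1)) by [].
have DP2 := is_derive_Phi_rhs y; have DG2 := is_derive_Gamma_rhs y.
have := (DP y, DG y, DP1 y, DG1 y) => -[[[? ?] ?] ?].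
apply: is_derive_eq.
rewrite /GRing.scale/= ?fctE /= /iP1 /iG1 /dissipation /xi_rhs /psi_rhs.
field.
by rewrite P1n0 G1n0.
Qed.

Lemma dissipation_ge0 y : 0 <= dissipation y.
Proof.
(* The coupling weight is nonnegative because Gamma' < 0. *)
have h1 : 0 <= 2 * G y * P y * P1 y by rewrite !mulr_ge0// ltW.
have h2 : 0 <= - (2 * G y * P y * P1 y * G1 y).
  by rewrite oppr_ge0 mulr_ge0_le0// ltW.
apply: addr_ge0; last by rewrite -mulNr mulr_ge0 ?sqr_ge0.
by rewrite addr_ge0 ?sqr_ge0// mulr_ge0 ?sqr_ge0// invr_ge0.
Qed.

Lemma flux_ndecr x y : x <= y -> flux x <= flux y.
Proof.
move=> xy; apply: (derive_ge0_le xy is_derive_flux) => z _.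
exact: dissipation_ge0.
Qed.

(** A positive value of the flux persists to +oo.  There the logarithmic
    derivatives of Phi' and Gamma' are bounded below, so the terms in xi^2 and
    psi^2 are negligible and (xi^2 / 2 + psi^2 / 4)' stays above half that
    value. *)
Lemma flux_le0 y :
  xi y @[y --> +oo] --> (0 : R) -> psi y @[y --> +oo] --> (0 : R) ->
  flux y <= 0.
Proof.
move=> xi0 psi0; rewrite leNgt; apply/negP => d0.
pose M : R := G y + 2 * beta + 1.
have M0 : 0 < M by have := Gamma_gt0 y; have := beta_gt0; rewrite /M; lra.
pose e := Num.sqrt (flux y / (2 * (M + 1))).
have e20 : 0 < flux y / (2 * (M + 1)) by rewrite divr_gt0//; lra.
have e0 : 0 < e by rewrite sqrtr_gt0.
have e2 : (M + 1) * e ^+ 2 = flux y / 2.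
  by rewrite sqr_sqrtr ?(ltW e20)//; field; rewrite gt_eqF//; lra.
have [a1 h1] := cvg0_pinfty e0 xi0.
have [a2 h2] := cvg0_pinfty e0 psi0.
have sq_le (x : R) : `|x| <= e -> x ^+ 2 <= e ^+ 2.
  by move=> xe; rewrite -real_normK ?num_real// lerXn2r ?nnegrE// ltW.
pose a := Num.max y (Num.max a1 a2).
have aP z : a <= z -> [/\ y <= z, xi z ^+ 2 <= e ^+ 2 & psi z ^+ 2 <= e ^+ 2].
  by rewrite !ge_max => /and3P[? ? ?]; split=> //; apply: sq_le; auto.
pose f := cst 2^-1 * xi ^+ 2 + cst 4^-1 * psi ^+ 2.
have Df z : is_derive z 1 f (xi z * xi1 z + 2^-1 * (psi z * psi1 z)).
  have := (Dxi z, Dpsi z) => -[? ?].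
  apply: is_derive_eq; rewrite /GRing.scale/= ?fctE /=; lra.
apply: (@slope_unbounded_pinfty _ f _ a (flux y / 2) (e ^+ 2) _ Df).
- by rewrite divr_gt0.
- move=> z az; have [yz xz pz] := aP z az.
  have hM : - M <= P2 z / P1 z.
    by rewrite ler_pdivlMr//; exact: (Phi_rhs_ge yz).
  have hN : - 2 <= G2 z / G1 z.
    have h := Gamma_rhs_le z.
    by rewrite ler_ndivlMr.
  have := flux_ndecr yz; rewrite /flux -/(flux y).
  have hx : xi z ^+ 2 * - M <= xi z ^+ 2 * (P2 z / P1 z).
    by rewrite ler_wpM2l ?sqr_ge0.
  have hp : psi z ^+ 2 * - 2 <= psi z ^+ 2 * (G2 z / G1 z).
    by rewrite ler_wpM2l ?sqr_ge0.
  have hx2 : M * xi z ^+ 2 <= M * e ^+ 2 by rewrite ler_pM2l.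
  lra.
- move=> z az; have [yz xz pz] := aP z az.
  rewrite /f !fctE; have := sqr_ge0 e; lra.
Qed.

(** A negative value of the flux persists to -oo.  There Phi'' / Phi' is at
    most Gamma^2 = O(y^2), which the decay of y xi absorbs, and the term in
    Gamma'' / Gamma' has the favourable sign; so (xi^2 / 2)' stays
    below a negative constant. *)
Lemma flux_ge0 y :
  y * xi y @[y --> -oo] --> (0 : R) ->
  psi y @[y --> -oo] --> (0 : R) -> psi1 y @[y --> -oo] --> (0 : R) ->
  0 <= flux y.
Proof.
move=> xi0 psi0 psi10; rewrite leNgt; apply/negP => dlt0.
pose d := - flux y; have d0 : 0 < d by rewrite oppr_gt0.
have b0 : 0 < Num.sqrt beta by rewrite sqrtr_gt0.
set b := Num.sqrt beta in b0.
pose e := Num.sqrt (d / 4) / (1 + b).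
have e0 : 0 < e by rewrite divr_gt0 ?sqrtr_gt0; lra.
have e2 : (1 + b) ^+ 2 * e ^+ 2 = d / 4.
  rewrite -exprMn mulrC divfK ?gt_eqF//; last lra.
  by rewrite sqr_sqrtr; lra.
pose e' := Num.sqrt (d / 2).
have e'0 : 0 < e' by rewrite sqrtr_gt0; lra.
have e'2 : e' ^+ 2 = d / 2 by rewrite sqr_sqrtr; lra.
have [a1 h1] := cvg0_ninfty e0 xi0.
have [a2 h2] := cvg0_ninfty e'0 psi0.
have [a3 h3] := cvg0_ninfty e'0 psi10.
have [a4 h4] := cvg0_ninfty ltr01 prof.(Gamma_asymp).
have sq_le (x c : R) : `|x| <= c -> x ^+ 2 <= c ^+ 2.
  move=> xc; rewrite -real_normK ?num_real// lerXn2r ?nnegrE//.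
  exact: le_trans xc.
pose a0 := Num.min (-1) (Num.min (- ((3 + beta) / b)) a4).
have GP z : z <= a0 -> [/\ z <= -1, 1 + beta <= G z ^+ 2 &
    G z ^+ 2 <= (1 + b) ^+ 2 * z ^+ 2].
  rewrite !le_min => /and3P[z1 z2 /h4]; rewrite -/b => /ler_normlP[g1 g2].
  have z3 : 3 + beta <= b * - z by rewrite mulrC -ler_pdivrMr// lerNr.
  have bz := beta_gt0.
  split=> //; first nra.
  rewrite -exprMn -[leRHS]sqrrN.
  rewrite lerXn2r ?nnegrE ?(ltW (Gamma_gt0 z))//; first nra.
  by nra.
pose a := Num.min (Num.min y a0) (Num.min a1 (Num.min a2 a3)).
have aP z : z <= a -> [/\ z <= y, z <= a0, (z * xi z) ^+ 2 <= e ^+ 2,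
    psi z ^+ 2 <= e' ^+ 2 & psi1 z ^+ 2 <= e' ^+ 2].
  rewrite !le_min => /andP[/andP[? ?] /and3P[? ? ?]].
  by split=> //; apply: sq_le; auto.
pose f := cst 2^-1 * xi ^+ 2.
have Df z : is_derive z 1 f (xi z * xi1 z).
  have := (Dxi z) => ?.
  apply: is_derive_eq; rewrite /GRing.scale/= ?fctE /=; lra.
apply: (@slope_unbounded_ninfty _ f _ a (d / 2) (e ^+ 2) _ Df).
- by rewrite divr_gt0.
- move=> z za; have [zy za0 xz pz p1z] := aP z za.
  have [z1 g1 g2] := GP z za0.
  have PP1 : P z <= P1 z.
    by apply: (Phi_le_dPhi (a := a0)) => // x /GP[].
  have hP : P2 z / P1 z <= (1 + b) ^+ 2 * z ^+ 2.
    rewrite ler_pdivrMr//.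
    apply: (@le_trans _ _ (G z ^+ 2 * P z)).
      rewrite /Phi_rhs gerDl mulr_ge0_le0 ?subr_le0 ?expr_le1//.
      + by rewrite mulr_ge0// ltW.
      + exact: ltW.
      + exact: ltW.
    by rewrite ler_pM// ?sqr_ge0 ?ltW.
  have hxi : xi z ^+ 2 * (P2 z / P1 z) <= d / 4.
    apply: (@le_trans _ _ (xi z ^+ 2 * ((1 + b) ^+ 2 * z ^+ 2))).
      by rewrite ler_wpM2l ?sqr_ge0.
    have -> : xi z ^+ 2 * ((1 + b) ^+ 2 * z ^+ 2) =
        (1 + b) ^+ 2 * (z * xi z) ^+ 2 by ring.
    by rewrite -e2 ler_wpM2l ?sqr_ge0.
  have hG : psi z ^+ 2 * (G2 z / G1 z) <= 0.
    rewrite mulr_ge0_le0 ?sqr_ge0// ler_ndivrMr// mul0r /Gamma_rhs.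
    by rewrite mulr_ge0 ?sqr_ge0// mulr_ge0// ltW.
  have hpp : - (psi z ^+ 2 + psi1 z ^+ 2) <= 2 * (psi z * psi1 z).
    have := sqr_ge0 (psi z + psi1 z); rewrite sqrrD -mulr_natl; lra.
  have : flux z <= - d by rewrite opprK; exact: flux_ndecr.
  rewrite /flux; lra.
- move=> z za; have [zy za0 xz pz p1z] := aP z za.
  have [z1 _ _] := GP z za0.
  have : xi z ^+ 2 <= (z * xi z) ^+ 2.
    rewrite exprMn ler_peMl ?sqr_ge0//; nra.
  rewrite /f !fctE; have := sqr_ge0 (xi z); lra.
Qed.

(** With no flux there is no dissipation, so u = v and v' = 0. *)
Lemma psi_proportional y :
  (forall z, flux z = 0) ->
  xi y / P1 y = psi y / G1 y /\ psi y / G1 y = psi 0 / G1 0.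
Proof.
move=> F0.
have D0 z : dissipation z = 0.
  have D1 : is_derive z 1 flux (dissipation z).
    exact: is_derive_flux.
  have e : flux = cst 0 by apply/funext.
  rewrite e in D1.
  have := @derive_val _ _ _ _ _ _ _ D1.
  by rewrite derive_cst => <-.
have parts z : xi z / P1 z = psi z / G1 z /\ psi1 z = psi z * (G2 z / G1 z).
  have c0 : 0 < - (2 * G z * P z * P1 z * G1 z).
    by rewrite oppr_gt0 pmulr_rlt0// !mulr_gt0.
  have := D0 z; rewrite /dissipation.
  set u := (X in X ^+ 2 + _ - _); set v := (X in _ + 2^-1 * X ^+ 2 - _).
  set w := (X in _ - _ * X ^+ 2) => uvw.
  have := sqr_ge0 u; have := sqr_ge0 v; have := sqr_ge0 w => w0 v0 u0.
  have cw : 0 <= - (2 * G z * P z * P1 z * G1 z) * w ^+ 2.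
    by rewrite mulr_ge0// ltW.
  have /eqP : v ^+ 2 = 0 by lra.
  have /eqP : - (2 * G z * P z * P1 z * G1 z) * w ^+ 2 = 0 by lra.
  rewrite mulf_eq0 (gt_eqF c0)/= !sqrf_eq0 !subr_eq0 => /eqP-> /eqP->.
  by [].
split; first by case: (parts y).
pose q := psi * (fun z => (G1 z)^-1).
have Dq z : is_derive z 1 q 0.
  have G1n0 : G1 z != 0 by rewrite lt_eqF.
  have iG := is_deriveV G1n0 (DG1 z).
  have := Dpsi z => ?.
  apply: is_derive_eq; rewrite /GRing.scale/= ?fctE /=.
  have [_ ->] := parts z; field; exact: G1n0.
exact: (is_derive_0_is_cst y 0 Dq).
Qed.

(** The constant ratio psi / Gamma' is zero because |Gamma'| is nonincreasing
    while psi tends to 0 at -oo. *)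
Lemma recessive_decaying_eq0 y :
  y * xi y @[y --> -oo] --> (0 : R) ->
  psi y @[y --> -oo] --> (0 : R) -> psi1 y @[y --> -oo] --> (0 : R) ->
  xi y @[y --> +oo] --> (0 : R) -> psi y @[y --> +oo] --> (0 : R) ->
  xi y = 0 /\ psi y = 0.
Proof.
move=> xiN psiN psi1N xiP psiP.
have F0 z : flux z = 0.
  apply/eqP; rewrite eq_le flux_le0//=.
  exact: flux_ge0.
have q0 : psi 0 / G1 0 = 0.
  apply/eqP; apply/negPn/negP => q0.
  pose e : R := `|psi 0 / G1 0 * G1 0|.
  have G10 : G1 0 != 0 by rewrite lt_eqF.
  have e0 : 0 < e by rewrite normr_gt0 mulf_neq0.
  have [a ha] := cvg0_ninfty (divr_gt0 e0 (ltr0Sn R 1)) psiN.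
  pose z := Num.min 0 a.
  have := ha z ltac:(by rewrite ge_min lexx orbT).
  have [_ qz] := psi_proportional z F0.
  have -> : psi z = psi 0 / G1 0 * G1 z.
    by rewrite -qz divfK// lt_eqF.
  have : e <= `|psi 0 / G1 0 * G1 z|.
    rewrite /e !normrM ler_wpM2l// !ltr0_norm// lerN2.
    by apply: dGamma_ndecr; rewrite ge_min lexx.
  lra.
have [xq pq] := psi_proportional y F0.
have P1n0 : P1 y != 0 by rewrite gt_eqF.
have G1n0 : G1 y != 0 by rewrite lt_eqF.
rewrite pq q0 in xq; rewrite q0 in pq.
move/eqP: xq; move/eqP: pq; rewrite !mulf_eq0 !invr_eq0.
rewrite (negPf P1n0) (negPf G1n0) !orbF.
by move=> /eqP-> /eqP->.
Qed.

End Interface.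

(** * Solutions as Cauchy vectors *)

Section CauchyVectors.
Set Implicit Arguments.
Unset Strict Implicit.
Variable R : realType.
Implicit Types (f : R -> R) (x y : R).

Lemma twice_derivableP f : twice_derivable f ->
  (forall y, is_derive y 1 f (f^`() y)) /\
  (forall y, is_derive y 1 f^`() (f^`(2) y)).
Proof.
move=> [d1 d2]; split=> y.
  by rewrite derive1E; apply: derivableP.
by rewrite derive1nS derive1n1 derive1E; apply: derivableP.
Qed.

Lemma is_derive_twice_derivable f (f1 f2 : R -> R) :
  (forall y, is_derive y 1 f (f1 y)) -> (forall y, is_derive y 1 f1 (f2 y)) ->
  [/\ twice_derivable f, f^`() = f1 & f^`(2) = f2].
Proof.
move=> D1 D2.
have e1 : f^`() = f1.
  by apply/funext => y; rewrite derive1E; case: (D1 y).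
have e2 : f^`(2) = f2.
  by apply/funext => y; rewrite derive1nS derive1n1 e1 derive1E; case: (D2 y).
split=> //; split=> y; first by case: (D1 y).
by rewrite e1; case: (D2 y).
Qed.

Lemma interface_profile (beta : R) (P G : R -> R) : 0 < beta ->
  interface beta P G -> interface_shape beta P G ->
  profile beta P P^`() G G^`().
Proof.
move=> b0 [[tP tG] eP eG [P0 G0] _] sh.
have [DP DP1] := twice_derivableP tP; have [DG DG1] := twice_derivableP tG.
split=> //.
- by move=> y; rewrite /Phi_rhs -eP.
- by move=> y; rewrite /Gamma_rhs -eG.
- by move=> y; case: (sh y) => /andP[].
- by move=> y; case: (sh y) => /andP[].
- by move=> y; case: (sh y).
- by move=> y; case: (sh y).
- by move=> y; case: (sh y) => _ _ _ /andP[].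
- by move=> y; case: (sh y) => _ _ _ /andP[].
Qed.

(** The equations in first-order form, the derivatives being the last two
    coordinates of the Cauchy vector. *)
Lemma lin_solutionP (beta : R) (P G : R -> R) (Z : R -> 'cV[R]_4) :
  lin_solution beta P G Z <->
  [/\ forall y, is_derive y 1 (xi_of Z) (Z y 2 0),
      forall y, is_derive y 1 (fun x => Z x 2 0 : R)
                  (xi_rhs beta P G (xi_of Z) (psi_of Z) y),
      forall y, is_derive y 1 (psi_of Z) (Z y 3 0) &
      forall y, is_derive y 1 (fun x => Z x 3 0 : R)
                  (psi_rhs P G (xi_of Z) (psi_of Z) y)].
Proof.
split=> [[[txi tpsi] Zc e1 e2]|[D1 D2 D3 D4]].
  have [Dx Dx1] := twice_derivableP txi; have [Dp Dp1] := twice_derivableP tpsi.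
  have E2 : (fun x => Z x 2 0 : R) = (xi_of Z)^`().
    by apply/funext => x; rewrite Zc !mxE.
  have E3 : (fun x => Z x 3 0 : R) = (psi_of Z)^`().
    by apply/funext => x; rewrite Zc !mxE.
  split=> y.
  - by have -> : Z y 2 0 = (xi_of Z)^`() y by rewrite -E2.
  - by rewrite E2 /xi_rhs -e1.
  - by have -> : Z y 3 0 = (psi_of Z)^`() y by rewrite -E3.
  - by rewrite E3 /psi_rhs -e2.
have [tx x1 x2] := is_derive_twice_derivable D1 D2.
have [tp p1 p2] := is_derive_twice_derivable D3 D4.
split=> // y; last 2 first.
- by rewrite x2.
- by rewrite p2.
apply/matrixP => i j; rewrite ord1 x1 p1 !mxE.
case: i => -[|[|[|[|//]]]] i /=; congr (Z y _ _); exact/val_inj.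
Qed.

Lemma lin_solution_comb (beta : R) (P G : R -> R) (Z1 Z2 : R -> 'cV[R]_4) a b :
  lin_solution beta P G Z1 -> lin_solution beta P G Z2 ->
  lin_solution beta P G (fun y => a *: Z1 y + b *: Z2 y).
Proof.
have ext (i : 'I_4) : (fun y => (a *: Z1 y + b *: Z2 y) i 0) =
    cst a * (fun y => Z1 y i 0 : R) + cst b * (fun y => Z2 y i 0 : R).
  by apply/funext => y; rewrite !mxE.
move=> /lin_solutionP[A0 A2 A1 A3] /lin_solutionP[B0 B2 B1 B3].
apply/lin_solutionP; split=> y; rewrite /xi_of /psi_of ?ext.
- have := (A0 y, B0 y) => -[? ?].
  apply: is_derive_eq; rewrite !mxE /GRing.scale/= ?fctE /=; ring.
- have := (A2 y, B2 y) => -[? ?].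
  apply: is_derive_eq; rewrite /xi_rhs /xi_of /psi_of.
  by rewrite /GRing.scale/= ?fctE /=; ring.
- have := (A1 y, B1 y) => -[? ?].
  apply: is_derive_eq; rewrite !mxE /GRing.scale/= ?fctE /=; ring.
- have := (A3 y, B3 y) => -[? ?].
  apply: is_derive_eq; rewrite /psi_rhs /xi_of /psi_of.
  by rewrite /GRing.scale/= ?fctE /=; ring.
Qed.

End CauchyVectors.

Section Nondegeneracy.
Set Implicit Arguments.
Unset Strict Implicit.
Variable R : realType.
Implicit Types (f : R -> R) (x y : R).

(** Both |y| and |y| `^ s are at most exponential in |y|, which the Gaussian
    factor beats: the product is below expR y for y sufficiently negative. *)
Lemma gaussian_mul_cvg0 (s b : R) : 0 < b ->
  y * (`|y| `^ s * expR (- (b * y ^+ 2 / 2))) @[y --> -oo] --> (0 : R).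
Proof.
move=> b0; apply/cvgr0Pnorm_le => eps eps0.
(* For |y| >= c, b y^2 / 2 exceeds (2 + |s|) |y|: a share 1 + |s| for the
   two factors, and one unit left for expR y. *)
pose c := 2 * (2 + `|s|) / b.
near=> y.
have y1 : y <= -1 by near: y; apply: nbhs_ninfty_le; exact: num_real.
have yc : y <= - c by near: y; apply: nbhs_ninfty_le; exact: num_real.
have ye : y <= ln eps by near: y; apply: nbhs_ninfty_le; exact: num_real.
have n0 : 0 < `|y| by rewrite normr_gt0; lra.
have nE : `|y| = - y by rewrite ler0_norm//; lra.
have lnle : ln `|y| <= `|y|.
  have := @le_ln1Dx _ (`|y| - 1).
  have -> : 1 + (`|y| - 1) = `|y| by ring.
  by move=> h; apply: le_trans (h _) _; lra.
have ln0 : 0 <= ln `|y| by rewrite ln_ge0// nE; lra.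
have -> : `|y * (`|y| `^ s * expR (- (b * y ^+ 2 / 2)))| =
    expR (ln `|y| + (s * ln `|y| - b * y ^+ 2 / 2)).
  rewrite normrM [X in _ * X]ger0_norm ?mulr_ge0 ?powR_ge0 ?expR_ge0//.
  by rewrite /powR gt_eqF// !expRD lnK ?posrE.
apply: (@le_trans _ _ (expR y)); last by rewrite -(lnK eps0) ler_expR.
rewrite ler_expR.
have h1 : s * ln `|y| <= `|s| * `|y|.
  apply: (@le_trans _ _ (`|s| * ln `|y|)); first by rewrite ler_wpM2r ?ler_norm.
  by rewrite ler_wpM2l.
have h2 : (2 + `|s|) * `|y| <= b * y ^+ 2 / 2.
  have : c * b / 2 <= - y * b / 2 by rewrite ler_pM2r// ler_pM2r//; lra.
  have -> : c * b / 2 = 2 + `|s| by rewrite /c; field; rewrite gt_eqF.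
  move=> h; apply: (@le_trans _ _ ((- y * b / 2) * `|y|)).
    by rewrite ler_wpM2r.
  by rewrite nE; lra.
by rewrite nE in h1 h2 lnle *; lra.
Unshelve. all: by end_near. Qed.

Lemma recessive_mul_cvg0 (beta : R) (Z : R -> 'cV[R]_4) : 0 < beta ->
  scalar_recessive beta Z -> y * xi_of Z y @[y --> -oo] --> (0 : R).
Proof.
move=> b0 [l hl].
have sb0 : 0 < Num.sqrt beta by rewrite sqrtr_gt0.
have := cvgM hl (gaussian_mul_cvg0 ((Num.sqrt beta - 1) / 2) sb0).
rewrite mulr0 => /(_ _) h; refine (cvg_trans _ h); apply: near_eq_cvg; near=> y.
have y0 : y < 0 by near: y; apply: nbhs_ninfty_lt; exact: num_real.
rewrite /=; set w := (X in _ / X).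
have w0 : w != 0.
  by rewrite mulf_neq0 ?gt_eqF ?expR_gt0// powR_gt0// normr_gt0 lt_eqF.
by rewrite /= mulrCA divfK.
Unshelve. all: by end_near. Qed.

Lemma no_decaying_recessive (beta : R) (P G : R -> R) (Z : R -> 'cV[R]_4) :
  profile beta P P^`() G G^`() -> lin_solution beta P G Z ->
  psi_vanishes Z -> scalar_recessive beta Z -> decays Z -> forall y, Z y = 0.
Proof.
move=> prof sol [psi0 psi10] rec [xiP psiP].
have b0 := prof.(beta_gt0).
have [_ Zc _ _] := sol.
have /lin_solutionP[D0 D2 D1 D3] := sol.
have e3 : (fun y => Z y 3 0 : R) = (psi_of Z)^`().
  by apply/funext => y; rewrite Zc !mxE.
have z0 y : xi_of Z y = 0 /\ psi_of Z y = 0.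
  apply: (recessive_decaying_eq0 prof D0 D2 D1 D3) => //.
  - exact: recessive_mul_cvg0 rec.
  - by rewrite e3.
have ex : xi_of Z = cst 0 by apply/funext => y; case: (z0 y).
have ep : psi_of Z = cst 0 by apply/funext => y; case: (z0 y).
move=> y; rewrite Zc ex ep !derive1_cst; apply/matrixP => i j; rewrite !mxE.
by case: i => -[|[|[|[|//]]]].
Qed.

(** Gronwall's inequality for the squared Euclidean norm of the Cauchy vector,
    whose derivative is at least - (1 + 4 M) times itself. *)
Lemma energy_backward (beta : R) (P G : R -> R) (Z : R -> 'cV[R]_4)
    (M a b : R) :
  lin_solution beta P G Z -> a <= b ->
  (forall y, a <= y <= b ->
    [/\ `|G y ^+ 2 + beta * (3 * P y ^+ 2 - 1)| <= M, `|2 * G y * P y| <= M,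
        `|4 * G y * P y| <= M & `|2 * P y ^+ 2| <= M]) ->
  enorm (Z a) ^+ 2 <= expR ((1 + 4 * M) * (b - a)) * enorm (Z b) ^+ 2.
Proof.
move=> /lin_solutionP[D0 D2 D1 D3] ab hM.
have enormE y : enorm (Z y) ^+ 2 =
    xi_of Z y ^+ 2 + psi_of Z y ^+ 2 + Z y 2 0 ^+ 2 + Z y 3 0 ^+ 2.
  rewrite sqr_sqrtr; last by apply: sumr_ge0 => i _; exact: sqr_ge0.
  rewrite !big_ord_recr big_ord0 /= add0r /xi_of /psi_of.
  by congr (_ ^+ 2 + _ ^+ 2 + _ ^+ 2 + _ ^+ 2); congr (Z y _ _); exact/val_inj.
pose L := 1 + 4 * M.
pose xi1 y : R := Z y 2 0; pose psi1 y : R := Z y 3 0.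
pose f := (xi_of Z ^+ 2 + psi_of Z ^+ 2 + xi1 ^+ 2 + psi1 ^+ 2) *
  (fun y => expR (L * y)).
pose S y : R := xi_of Z y * xi1 y + psi_of Z y * psi1 y
  + xi1 y * xi_rhs beta P G (xi_of Z) (psi_of Z) y
  + psi1 y * psi_rhs P G (xi_of Z) (psi_of Z) y.
pose df y : R := (2 * S y + L *
  (xi_of Z y ^+ 2 + psi_of Z y ^+ 2 + xi1 y ^+ 2 + psi1 y ^+ 2)) *
  expR (L * y).
have Df y : is_derive y 1 f (df y).
  have De := is_derive_expR_scale L y.
  have := (D0 y, D1 y, D2 y, D3 y) => -[[[? ?] ?] ?].
  apply: is_derive_eq; rewrite /df /S /GRing.scale/= ?fctE /xi1 /psi1 /=; ring.
have : f a <= f b.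
  apply: (derive_ge0_le ab Df) => y /hM [m1 m2 m3 m4].
  rewrite mulr_ge0 ?expR_ge0// /S /xi_rhs /psi_rhs.
  have prod_ge (c u v : R) : `|c| <= M ->
      - (M * (u ^+ 2 + v ^+ 2)) <= 2 * (u * (c * v)).
    move=> /ler_normlP[c1 c2].
    have q1 := mulr_ge0 (_ : 0 <= M - c) (sqr_ge0 (u - v)).
    have q2 := mulr_ge0 (_ : 0 <= M + c) (sqr_ge0 (u + v)).
    have := q1 ltac:(lra); have := q2 ltac:(lra); nra.
  have := prod_ge _ (xi1 y) (xi_of Z y) m1.
  have := prod_ge _ (xi1 y) (psi_of Z y) m2.
  have := prod_ge _ (psi1 y) (xi_of Z y) m3.
  have := prod_ge _ (psi1 y) (psi_of Z y) m4.
  have := sqr_ge0 (xi1 y + xi_of Z y); have := sqr_ge0 (psi1 y + psi_of Z y).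
  have M0 : 0 <= M by exact: le_trans m1.
  have := mulr_ge0 M0 (sqr_ge0 (xi1 y)); have := mulr_ge0 M0 (sqr_ge0 (psi1 y)).
  have := mulr_ge0 M0 (sqr_ge0 (xi_of Z y)).
  have := mulr_ge0 M0 (sqr_ge0 (psi_of Z y)).
  rewrite /L; lra.
rewrite !enormE -/(xi1 a) -/(psi1 a) -/(xi1 b) -/(psi1 b) /f !fctE.
have -> : expR ((1 + 4 * M) * (b - a)) = expR (L * b) / expR (L * a).
  by rewrite -expRN -expRD; congr expR; rewrite /L; ring.
move=> h; rewrite mulrAC ler_pdivlMr ?expR_gt0//.
by rewrite [leRHS]mulrC.
Qed.

End Nondegeneracy.

(** * Uniform injectivity of a continuous family of matrices *)

Section UniformInjectivity.
Set Implicit Arguments.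
Unset Strict Implicit.
Variable R : realType.

Definition entrywise_continuous (S : topologicalType) m n
    (A : S -> 'M[R]_(m, n)) :=
  forall i j, continuous (fun t => A t i j).

Section Continuity.
Variable S : topologicalType.

Lemma continuous_bigsum (I : Type) (r : seq I) (F : I -> S -> R) :
  (forall i, continuous (F i)) ->
  continuous (fun t => \sum_(i <- r) F i t).
Proof.
move=> cF; elim: r => [|i r ih] t.
  under eq_fun do rewrite big_nil.
  exact: cvg_cst.
under eq_fun do rewrite big_cons.
by apply: cvgD; [exact: cF|exact: ih].
Qed.

Lemma continuous_bigprod (I : Type) (r : seq I) (F : I -> S -> R) :
  (forall i, continuous (F i)) ->
  continuous (fun t => \prod_(i <- r) F i t).
Proof.
move=> cF; elim: r => [|i r ih] t.
  under eq_fun do rewrite big_nil.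
  exact: cvg_cst.
under eq_fun do rewrite big_cons.
by apply: cvgM; [exact: cF|exact: ih].
Qed.

Lemma continuous_mulmx m n p (A : S -> 'M[R]_(m, n)) (B : S -> 'M[R]_(n, p)) :
  entrywise_continuous A -> entrywise_continuous B ->
  entrywise_continuous (fun t => A t *m B t).
Proof.
move=> cA cB i j; under eq_fun do rewrite mxE.
by apply: continuous_bigsum => k t; apply: cvgM; [exact: cA|exact: cB].
Qed.

Lemma continuous_trmx m n (A : S -> 'M[R]_(m, n)) :
  entrywise_continuous A -> entrywise_continuous (fun t => (A t)^T).
Proof. by move=> cA i j; under eq_fun do rewrite mxE; exact: cA. Qed.

Lemma continuous_det n (A : S -> 'M[R]_n) :
  entrywise_continuous A -> continuous (fun t => \det (A t)).
Proof.
move=> cA; apply: continuous_bigsum => s t.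
apply: cvgM; first exact: cvg_cst.
by apply: continuous_bigprod => i; exact: cA.
Qed.

Lemma continuous_adj n (A : S -> 'M[R]_n) :
  entrywise_continuous A -> entrywise_continuous (fun t => \adj (A t)).
Proof.
move=> cA i j; under eq_fun do rewrite mxE.
move=> t; apply: cvgM; first exact: cvg_cst.
apply: continuous_det => k l; under eq_fun do rewrite !mxE.
exact: cA.
Qed.

End Continuity.

Lemma norm_coord_le_enorm n (v : 'cV[R]_n) i : `|v i 0| <= enorm v.
Proof.
rewrite -sqrtr_sqr ler_wsqrtr// (bigD1 i)//= lerDl sumr_ge0// => j _.
exact: sqr_ge0.
Qed.

Lemma enorm_ge0 n (v : 'cV[R]_n) : 0 <= enorm v.
Proof. exact: sqrtr_ge0. Qed.

Lemma enorm_le_sum n (v : 'cV[R]_n) : enorm v <= \sum_i `|v i 0|.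
Proof.
have s0 : 0 <= \sum_i `|v i 0| by apply: sumr_ge0.
rewrite -(ler_pXn2r (n := 2)) ?nnegrE ?enorm_ge0// sqr_sqrtr; last first.
  by apply: sumr_ge0 => i _; exact: sqr_ge0.
rewrite expr2 mulr_suml ler_sum// => i _.
rewrite -real_normK ?num_real// expr2 ler_wpM2l// (bigD1 i)//= lerDl.
by apply: sumr_ge0.
Qed.

(** A kernel vector v of the Gram matrix satisfies |A v|^2 = 0. *)
Lemma gram_det_neq0 m n (A : 'M[R]_(m, n)) :
  (forall z : 'cV[R]_n, A *m z = 0 -> z = 0) -> \det (A^T *m A) != 0.
Proof.
move=> injA; apply/negP => /det0P[v v0 vA].
have /eqP : v *m (A^T *m A) *m v^T = 0 by rewrite vA mul0mx.
rewrite mulmxA -mulmxA -[v *m A^T]trmxK trmx_mul trmxK.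
set w := A *m v^T => /eqP w0.
have ww : \sum_i w i 0 ^+ 2 = 0.
  have w00 : (w^T *m w) 0 0 = 0 by rewrite w0 mxE.
  rewrite -[RHS]w00 mxE; apply: eq_bigr => i _.
  by rewrite [w^T _ _]mxE expr2.
have /injA : w = 0.
  apply/matrixP => i j; rewrite ord1 [RHS]mxE.
  have := psumr_eq0P (fun i _ => sqr_ge0 (w i 0)) ww => /(_ i isT) /eqP.
    by rewrite sqrf_eq0 => /eqP.
by move=> /(congr1 trmx); rewrite trmxK trmx0 => /eqP; rewrite (negPf v0).
Qed.

(** By Cramer's rule for the Gram matrix, the adjugate times A^T is, up to the
    factor \det (A^T A), a left inverse of A with continuous entries; the
    extreme value theorem bounds the determinant below and the entries
    above. *)
Lemma uniformly_injective m n (a b : R) (A : R -> 'M[R]_(m, n)) : a <= b ->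
  (forall i j, {within `[a, b], continuous (fun t => A t i j)}) ->
  (forall t, `[a, b] t -> forall z : 'cV[R]_n, A t *m z = 0 -> z = 0) ->
  exists c : R, 0 < c /\ forall t, `[a, b] t -> forall z : 'cV[R]_n,
    c * enorm z <= enorm (A t *m z).
Proof.
move=> ab cA injA.
pose D t := \det ((A t)^T *m A t).
pose P t := \adj ((A t)^T *m A t) *m (A t)^T.
have cA' : entrywise_continuous (A : subspace `[a, b] -> _) by exact: cA.
have cG := continuous_mulmx (continuous_trmx cA') cA'.
have cP : entrywise_continuous (P : subspace `[a, b] -> _).
  exact: continuous_mulmx (continuous_adj cG) (continuous_trmx cA').
have cD : {within `[a, b], continuous (fun t => `|D t|)}.
  by move=> t; apply: cvg_norm; exact: continuous_det cG t.
have cS : {within `[a, b], continuous (fun t => \sum_i \sum_j `|P t i j|)}.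
  apply: continuous_bigsum => i; apply: continuous_bigsum => j t.
  by apply: cvg_norm; exact: cP.
have [t1 t1J minD] := EVT_min ab cD.
have [t2 t2J maxS] := EVT_max ab cS.
set d := `|D t1| in minD; set s := \sum_i _ in maxS.
have d0 : 0 < d by rewrite normr_gt0 gram_det_neq0//; exact: injA.
have s0 : 0 <= s by apply: sumr_ge0 => i _; apply: sumr_ge0.
exists (d / (s + 1)); split; first by rewrite divr_gt0//; lra.
move=> t tJ z; set w := A t *m z.
have Pw : P t *m w = D t *: z.
  by rewrite /P /w -mulmxA [X in _ *m X]mulmxA mulmxA mul_adj_mx mul_scalar_mx.
rewrite mulrAC ler_pdivrMr; last lra.
apply: (@le_trans _ _ (`|D t| * \sum_i `|z i 0|)).
  by rewrite ler_pM ?enorm_ge0 ?(ltW d0) ?enorm_le_sum ?minD.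
apply: (@le_trans _ _ (\sum_i \sum_j `|P t i j| * enorm w)).
  rewrite mulr_sumr ler_sum// => i _.
  have -> : `|D t| * `|z i 0| = `|(P t *m w) i 0| by rewrite Pw mxE normrM.
  rewrite mxE (le_trans (ler_norm_sum _ _ _))// ler_sum// => j _.
  by rewrite normrM ler_wpM2l// norm_coord_le_enorm.
under eq_bigr do rewrite -mulr_suml.
rewrite -mulr_suml mulrC ler_wpM2l ?enorm_ge0//.
by apply: le_trans (maxS t tJ) _; lra.
Qed.

Lemma lin_rank_injective m n (f : {linear 'cV[R]_m -> 'cV[R]_n}) :
  (forall z, f z = 0 -> z = 0) -> lin_rank f = m.
Proof.
move=> injf; rewrite /lin_rank limg_dim_eq.
  by rewrite dimvf /dim /= muln1.
apply/eqP; rewrite -subv0; apply/subvP => z.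
rewrite memv_cap memv_ker lfunE memv0.
by move=> /andP[_ /eqP /injf ->].
Qed.

End UniformInjectivity.

(** * The matching map *)

Section Matching.
Set Implicit Arguments.
Unset Strict Implicit.
Variable R : realType.

Definition matching_mx (l H G : 'cV[R]_4) : 'M[R]_(4, 3) :=
  \matrix_(i, j) [:: l i 0; - H i 0; - G i 0]`_j.

Lemma matching_mxE (l H G : 'cV[R]_4) (z : 'cV[R]_3) :
  matching_mx l H G *m z = matching 1%:M l H G z.
Proof.
rewrite /matching mul1mx; apply/matrixP => i j; rewrite ord1 !mxE.
rewrite !big_ord_recr big_ord0 /= add0r !mxE /=.
have -> : widen_ord (leqnSn 2) (widen_ord (leqnSn 1) ord_max) = 0 :> 'I_3.
  exact/val_inj.
have -> : widen_ord (leqnSn 2) ord_max = 1 :> 'I_3 by exact/val_inj.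
have -> : ord_max = 2 :> 'I_3 by exact/val_inj.
ring.
Qed.

Lemma cV3_eq0 (z : 'cV[R]_3) : z 0 0 = 0 -> z 1 0 = 0 -> z 2 0 = 0 -> z = 0.
Proof.
move=> z0 z1 z2; apply/matrixP => i j; rewrite ord1 mxE.
case: i => -[|[|[|//]]] i.
- by rewrite -[RHS]z0; congr (z _ _); exact/val_inj.
- by rewrite -[RHS]z1; congr (z _ _); exact/val_inj.
- by rewrite -[RHS]z2; congr (z _ _); exact/val_inj.
Qed.

Lemma decays_comb (Z1 Z2 : R -> 'cV[R]_4) (a b : R) :
  decays Z1 -> decays Z2 -> decays (fun y => a *: Z1 y + b *: Z2 y).
Proof.
have comb (i : 'I_4) : Z1 y i 0 @[y --> +oo] --> (0 : R) ->
    Z2 y i 0 @[y --> +oo] --> (0 : R) ->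
    (a *: Z1 y + b *: Z2 y) i 0 @[y --> +oo] --> (0 : R).
  move=> c1 c2; under eq_fun do rewrite !mxE.
  have -> : (0 : R) = a * 0 + b * 0 by rewrite !mulr0 addr0.
  by apply: cvgD; apply: cvgM => //; exact: cvg_cst.
by move=> [? ?] [? ?]; split; exact: comb.
Qed.

Variables (beta : R) (P G : R -> R) (T : R -> R -> 'M[R]_4).
Variables (y0 : R) (l : 'cV[R]_4) (ZH ZG : R -> 'cV[R]_4).
Hypothesis prof : profile beta P P^`() G G^`().
Hypothesis transT : is_transfer beta P G T.
Hypothesis l00 : l 0 0 = 1.
Hypothesis spanl : Eminus beta P G y0 = [set a *: l | a in [set: R]].
Hypothesis basis : basis_of_decaying beta P G ZH ZG.

(** The link between matching maps at different points: all of them evaluate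
    one solution, which is the recessive solution minus the decaying one.  If
    it vanishes identically, then the recessive solution decays, so both are
    zero, and the coefficients vanish because l has first coordinate 1 and the
    decaying solutions are independent. *)
Lemma matching_solution (z : 'cV[R]_3) : exists D : R -> 'cV[R]_4,
  [/\ lin_solution beta P G D,
      forall y, D y = matching (T y y0) l (ZH y) (ZG y) z,
      D y0 = matching 1%:M l (ZH y0) (ZG y0) z &
      (forall y, D y = 0) -> z = 0].
Proof.
have [[sH dH] [sG dG] free _] := basis.
have : Eminus beta P G y0 (z 0 0 *: l) by rewrite spanl; exists (z 0 0).
move=> [W [sW rW pW eW]].
pose V y := z 1 0 *: ZH y + z 2 0 *: ZG y.
have sV : lin_solution beta P G V by exact: lin_solution_comb.
exists (fun y => 1 *: W y + (-1) *: V y).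
have DE y : 1 *: W y + (-1) *: V y = W y - z 1 0 *: ZH y - z 2 0 *: ZG y.
  by rewrite scale1r scaleN1r /V opprD addrA.
split=> [|y||D0]; first exact: lin_solution_comb.
- by rewrite DE /matching (transT sW y y0) eW.
- by rewrite DE /matching mul1mx eW.
have WV : W = V.
  apply/funext => y; apply/eqP; rewrite -subr_eq0; apply/eqP.
  by have := D0 y; rewrite scale1r scaleN1r.
have dW : decays W by rewrite WV; exact: decays_comb.
have W0 := no_decaying_recessive prof sW pW rW dW.
have z0 : z 0 0 = 0.
  have := congr1 (fun v : 'cV[R]_4 => v 0 0) eW.
  by rewrite W0 !mxE l00 mulr1 => <-.
have [|z1 z2] := free (z 1 0) (z 2 0).
  by move=> y; rewrite -/(V y) -WV W0.
exact: cV3_eq0.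
Qed.

(** The transfer matrix carries a zero of a solution to every other point. *)
Lemma matching_injective y (z : 'cV[R]_3) :
  matching (T y y0) l (ZH y) (ZG y) z = 0 -> z = 0.
Proof.
have [D [sD DE _ inj]] := matching_solution z.
move=> m0; apply: inj => x.
by rewrite (transT sD x y) DE m0 mulmx0.
Qed.

Lemma matching1_injective (z : 'cV[R]_3) :
  matching 1%:M l (ZH y0) (ZG y0) z = 0 -> z = 0.
Proof.
have [D [sD _ D0 inj]] := matching_solution z.
move=> m0; apply: inj => x.
by rewrite (transT sD x y0) D0 m0 mulmx0.
Qed.

End Matching.

Section Bounds.
Set Implicit Arguments.
Unset Strict Implicit.
Variable R : realType.

Lemma coefficient_bounds (beta K y : R) (P P1 G G1 : R -> R) :
  profile beta P P1 G G1 -> beta <= 4 -> 0 <= K -> - K <= y ->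
  let M := (3 + 2 * K) ^+ 2 + 4 * (3 + 2 * K) + 8 in
  [/\ `|G y ^+ 2 + beta * (3 * P y ^+ 2 - 1)| <= M, `|2 * G y * P y| <= M,
      `|4 * G y * P y| <= M & `|2 * P y ^+ 2| <= M].
Proof.
move=> prof beta4 K0 Ky M.
have b0 := prof.(beta_gt0).
have G0 := prof.(Gamma_gt0) y.
have P0 := prof.(Phi_gt0) y; have Pl := prof.(Phi_lt1) y.
have := Gamma_le prof beta4 K0 Ky; set g := 3 + 2 * K => Gg.
have g3 : 3 <= g by rewrite /g; lra.
have ME : M = g ^+ 2 + 4 * g + 8 by [].
have Pq : P y ^+ 2 <= 1 by rewrite expr_le1// ltW.
have P2 := sqr_ge0 (P y).
have GP : 0 <= G y * P y <= g.
  by rewrite mulr_ge0 ?(ltW G0) ?(ltW P0)//= -[g]mulr1 ler_pM// ltW.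
have /andP[GP0 GPg] := GP.
have G2 : G y ^+ 2 <= g ^+ 2 by rewrite lerXn2r ?nnegrE ?(ltW G0)//; lra.
have G20 := sqr_ge0 (G y).
have bp : 0 <= beta * P y ^+ 2 <= beta.
  by rewrite mulr_ge0 ?(ltW b0)//= ler_piMr// ltW.
have /andP[bp0 bp1] := bp.
have g20 := sqr_ge0 g.
by rewrite ME; split; apply/ler_normlP; split; lra.
Qed.

End Bounds.

Theorem proposition3p9 (R : realType)
    (Phi Gamma : R -> R -> R)
    (interfaceP : forall beta : R, 0 < beta < 4 ->
       unique_interface beta (Phi beta) (Gamma beta))
    (shapeP : forall beta : R, 0 < beta < 4 ->
       interface_shape beta (Phi beta) (Gamma beta))
    (bmin bmax : R) (bmin_gt0 : 0 < bmin) (bmin_le_bmax : bmin <= bmax)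
    (bmax_lt4 : bmax < 4)
    (T : R -> R -> R -> 'M[R]_4)
    (transferP : forall beta : R, `[bmin, bmax] beta ->
       is_transfer beta (Phi beta) (Gamma beta) (T beta))
    (ell : R -> R -> 'cV[R]_4)
    (ellP : Eminus_spanned `[bmin, bmax] Phi Gamma ell)
    (ZH ZG : R -> R -> 'cV[R]_4)
    (basisP : asymptotic_basis `[bmin, bmax] Phi Gamma ZH ZG) :
  (forall beta : R, `[bmin, bmax] beta ->
     ~ exists Z : R -> 'cV[R]_4,
         [/\ lin_solution beta (Phi beta) (Gamma beta) Z,
             exists y, Z y <> 0,
             psi_vanishes Z, scalar_recessive beta Z & decays Z])
  /\
  (exists K0 : R, forall K : R, K0 <= K ->
     [/\ forall beta : R, `[bmin, bmax] beta ->
           lin_rank (matching (T beta K (- K)) (ell beta (- K))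
                              (ZH beta K) (ZG beta K)) = 3%N,
         exists c : R, 0 < c /\
           forall beta : R, `[bmin, bmax] beta -> forall z : 'cV[R]_3,
             c * enorm z <=
             enorm (matching (T beta K (- K)) (ell beta (- K))
                             (ZH beta K) (ZG beta K) z) &
         forall beta : R, `[bmin, bmax] beta -> forall ystar : R,
           lin_rank (matching (T beta ystar (- K)) (ell beta (- K))
                              (ZH beta ystar) (ZG beta ystar)) = 3%N]).
Proof.
have bJ beta : `[bmin, bmax] beta -> 0 < beta < 4.
  by rewrite /= in_itv/= => /andP[? ?]; apply/andP; split; lra.
have prof beta : `[bmin, bmax] beta ->
    profile beta (Phi beta) (Phi beta)^`() (Gamma beta) (Gamma beta)^`().
  move=> /bJ b04; have /andP[b0 _] := b04.
  have [intf _] := interfaceP beta b04.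
  exact: interface_profile b0 intf (shapeP beta b04).
split.
  move=> beta bJb [Z [sol [y Zy] psiZ recZ decZ]]; apply: Zy.
  exact: no_decaying_recessive (prof beta bJb) sol psiZ recZ decZ y.
have [Y0 hY0] := ellP.
have [basis cZ _] := basisP.
exists (Num.max Y0 0) => K; rewrite ge_max => /andP[YK K0].
have [cell ellK] := hY0 K YK.
have inj beta y z : `[bmin, bmax] beta ->
    matching (T beta y (- K)) (ell beta (- K)) (ZH beta y) (ZG beta y) z = 0 ->
    z = 0.
  move=> bJb; have [e1 spanE] := ellK beta bJb.
  exact: matching_injective (prof beta bJb) (transferP beta bJb) e1 spanE
    (basis beta bJb) y z.
have rank3 beta : `[bmin, bmax] beta -> forall y,
    lin_rank (matching (T beta y (- K)) (ell beta (- K))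
      (ZH beta y) (ZG beta y)) = 3%N.
  by move=> bJb y; apply: lin_rank_injective => z; exact: inj.
split=> [beta bJb||beta bJb y]; [exact: rank3| |exact: rank3].
(* The matching map at - K involves only data continuous in beta. *)
pose A beta := matching_mx (ell beta (- K)) (ZH beta (- K)) (ZG beta (- K)).
have entry_continuous (v : R -> 'cV[R]_4) (i : 'I_4) :
    {within `[bmin, bmax], continuous v} ->
    {within `[bmin, bmax], continuous (fun beta => v beta i 0)}.
  move=> cv t.
  apply: (@continuous_comp (subspace `[bmin, bmax]) _ _ v (fun w => w i 0)).
    exact: cv.
  exact: coord_continuous.
have cA i j : {within `[bmin, bmax], continuous (fun beta => A beta i j)}.
  have [cH cG] := cZ (- K).
  have -> : (fun beta => A beta i j) = (fun beta => [:: ell beta (- K) i 0;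
      - ZH beta (- K) i 0; - ZG beta (- K) i 0]`_j).
    by apply/funext => beta; rewrite mxE.
  case: j => -[|[|[|//]]] j /=.
  - exact: entry_continuous.
  - by move=> t; apply: cvgN; exact: entry_continuous.
  - by move=> t; apply: cvgN; exact: entry_continuous.
have injA beta : `[bmin, bmax] beta ->
    forall z : 'cV[R]_3, A beta *m z = 0 -> z = 0.
  move=> bJb z; rewrite matching_mxE; have [e1 spanE] := ellK beta bJb.
  exact: matching1_injective (prof beta bJb) (transferP beta bJb) e1 spanE
    (basis beta bJb) z.
have [c0 [c00 hc0]] := uniformly_injective bmin_le_bmax cA injA.
pose M := (3 + 2 * K) ^+ 2 + 4 * (3 + 2 * K) + 8.
pose L := expR ((1 + 4 * M) * (K - - K)).
have L0 : 0 < Num.sqrt L by rewrite sqrtr_gt0 expR_gt0.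
exists (c0 / Num.sqrt L); split; first by rewrite divr_gt0.
move=> beta bJb z; have [e1 spanE] := ellK beta bJb.
have [D [sD DE D0 _]] := matching_solution (prof beta bJb) (transferP beta bJb)
  e1 spanE (basis beta bJb) z.
rewrite mulrAC ler_pdivrMr//.
apply: le_trans (hc0 beta bJb z) _; rewrite matching_mxE -D0 -DE.
have KK : - K <= K by lra.
have beta4 : beta <= 4 by have /andP[_ /ltW] := bJ beta bJb.
have := energy_backward sD KK (M := M) => /(_ _)/wrap[].
  move=> y /andP[Ky _]; exact: coefficient_bounds (prof beta bJb) beta4 K0 Ky.
rewrite -/L -[L in L * _]sqr_sqrtr ?expR_ge0// -exprMn mulrC.
by rewrite ler_pXn2r ?nnegrE ?mulr_ge0 ?enorm_ge0 ?(ltW L0).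
Qed.
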